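(* Let $N$ be a positive integer, let $\ell\in\{0,1,\ldots,N-1\}$, and let $$C_{N}=\left(1+\left(\frac{3-\sqrt{5}}{2}\right)^{N}\right)\left(1-\left(\frac{3-\sqrt{5}}{2}\right)^{N}\right)^{-1}.$$ Then $$\frac{F_{2N-2\ell}+(-1)^N F_{2\ell}+(-1)^{\ell+1}F_{2N}}{\frac{1}{2}L_{2N}-(-1)^N}=\sqrt{5}\,F_{\ell}^{2}\,C_{N}^{(-1)^N}-F_{2\ell}.$$
   Context: $F_n$ and $L_n$ are the Fibonacci and Lucas numbers: $F_0=0$, $F_1=1$, $F_n=F_{n-1}+F_{n-2}$ and $L_0=2$, $L_1=1$, $L_n=L_{n-1}+L_{n-2}$ for $n\ge 2$. The exponent in $C_N^{(-1)^N}$ means $C_N$ if $N$ is even and $1/C_N$ if $N$ is odd. *)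

(* Defs.v *)
From mathcomp Require Import all_boot all_order all_algebra.
From mathcomp Require Import reals.
Set Implicit Arguments.
Unset Strict Implicit.
Unset Printing Implicit Defensive.
Import Order.TTheory GRing.Theory Num.Theory.

Fixpoint fib (n : nat) : nat :=
  match n with
  | 0 => 0
  | 1 => 1
  | (m.+1 as p).+1 => fib p + fib m
  end.

Fixpoint lucas (n : nat) : nat :=
  match n with
  | 0 => 2
  | 1 => 1
  | (m.+1 as p).+1 => lucas p + lucas m
  end.

Local Open Scope ring_scope.

Definition Cconst (R : realType) (N : nat) : R :=
  (1 + ((3 - Num.sqrt 5) / 2) ^+ N) * (1 - ((3 - Num.sqrt 5) / 2) ^+ N)^-1.

(* Main.v *)
(** With A = phi^N, B = psi^N, a = phi^l, b = psi^l for the two roots phi, psi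
    of X^2 - X - 1, one has AB = (-1)^N, ab = (-1)^l and, since
    psi^2 = (3 - sqrt 5)/2, C_N^((-1)^N) = (A + B)/(A - B) for both parities
    of N.  The denominator on the left is (A - B)^2/2, so Binet's formulas turn
    the claim into an identity between rational functions of A, B, a, b. *)
Require Import Defs.
From mathcomp Require Import all_boot all_order all_algebra.
From mathcomp Require Import reals ring lra.
Set Implicit Arguments.
Unset Strict Implicit.
Unset Printing Implicit Defensive.
Import Order.TTheory GRing.Theory Num.Theory.
Local Open Scope ring_scope.

Lemma fibSS n : fib n.+2 = (fib n.+1 + fib n)%N.
Proof. by []. Qed.

Lemma lucasSS n : lucas n.+2 = (lucas n.+1 + lucas n)%N.
Proof. by []. Qed.

Lemma fib_gt0 n : (0 < n)%N -> (0 < fib n)%N.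
Proof.
by case: n => // n _; elim: n => // n IHn; rewrite fibSS addn_gt0 IHn.
Qed.

Lemma two_step_ind (P : nat -> Prop) :
  P 0%N -> P 1%N -> (forall n, P n -> P n.+1 -> P n.+2) -> forall n, P n.
Proof.
move=> P0 P1 PSS n; suff [] : P n /\ P n.+1 by [].
by elim: n => // n [Pn Pn1]; split => //; apply: PSS.
Qed.

Section Binet.
Variable R : realType.

Definition phi : R := (1 + Num.sqrt 5) / 2.
Definition psi : R := (1 - Num.sqrt 5) / 2.

Lemma sqr_sqrt5 : Num.sqrt 5 ^+ 2 = 5 :> R.
Proof. by rewrite sqr_sqrtr ?ler0n. Qed.

Lemma sqrt5_neq0 : Num.sqrt 5 != 0 :> R.
Proof. by rewrite gt_eqF // sqrtr_gt0 ltr0n. Qed.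

Lemma sqr_phi : phi ^+ 2 = phi + 1.
Proof. by have := sqr_sqrt5; rewrite /phi; lra. Qed.

Lemma sqr_psi : psi ^+ 2 = psi + 1.
Proof. by have := sqr_sqrt5; rewrite /psi; lra. Qed.

Lemma phi_psi : phi * psi = -1.
Proof. by have := sqr_sqrt5; rewrite /phi /psi; lra. Qed.

Lemma phi_psi_exp n : phi ^+ n * psi ^+ n = (-1) ^+ n.
Proof. by rewrite -exprMn phi_psi. Qed.

Lemma phiSS n : phi ^+ n.+2 = phi ^+ n.+1 + phi ^+ n.
Proof. by rewrite -addn2 exprD sqr_phi exprSr; ring. Qed.

Lemma psiSS n : psi ^+ n.+2 = psi ^+ n.+1 + psi ^+ n.
Proof. by rewrite -addn2 exprD sqr_psi exprSr; ring. Qed.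

(** Keeping [Num.sqrt 5] as a factor on the left leaves the induction free of division. *)
Lemma binet_fib n : Num.sqrt 5 * (fib n)%:R = phi ^+ n - psi ^+ n.
Proof.
elim/two_step_ind: n => [||n IHn IHn1].
- by rewrite !expr0 mulr0 subrr.
- by rewrite !expr1 /phi /psi /=; lra.
- by rewrite fibSS natrD mulrDr IHn IHn1 phiSS psiSS; ring.
Qed.

Lemma binet_lucas n : (lucas n)%:R = phi ^+ n + psi ^+ n.
Proof.
elim/two_step_ind: n => [||n IHn IHn1].
- by rewrite !expr0.
- by rewrite !expr1 /phi /psi /=; lra.
- by rewrite lucasSS natrD IHn IHn1 phiSS psiSS; ring.
Qed.

Lemma fibE n : (fib n)%:R = (phi ^+ n - psi ^+ n) / Num.sqrt 5.
Proof. by rewrite -binet_fib mulrC mulKf ?sqrt5_neq0. Qed.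

(** By Binet the difference is [Num.sqrt 5] times a positive Fibonacci number, so the two powers
    need not be compared in size. *)
Lemma phi_psi_sub_neq0 n : (0 < n)%N -> phi ^+ n - psi ^+ n != 0.
Proof.
by move=> n_gt0; rewrite -binet_fib mulf_neq0 ?sqrt5_neq0 // pnatr_eq0 -lt0n fib_gt0.
Qed.

Lemma CconstE n : Cconst R n = (1 + (psi ^+ n) ^+ 2) / (1 - (psi ^+ n) ^+ 2).
Proof.
rewrite /Cconst exprAC; suff -> : (3 - Num.sqrt 5) / 2 = psi ^+ 2 by [].
by rewrite sqr_psi /psi; lra.
Qed.

Lemma phi_neq0 : phi != 0.
Proof.
by apply/eqP => p0; have /eqP := phi_psi; rewrite p0 mul0r eq_sym oppr_eq0 oner_eq0.
Qed.

Lemma Cconst_exp n : (0 < n)%N ->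
  Cconst R n ^ ((-1 : int) ^+ n)
  = (phi ^+ n + psi ^+ n) / (phi ^+ n - psi ^+ n).
Proof.
move=> n_gt0; have dn0 := phi_psi_sub_neq0 n_gt0.
have An0 : phi ^+ n != 0 by rewrite expf_neq0 ?phi_neq0.
have := phi_psi_exp n; rewrite CconstE -signr_odd -(signr_odd int).
move: (phi ^+ n) (psi ^+ n) dn0 An0 => A B dn0 An0.
(* Expanding by [A] creates the product [A * B], which is the sign: the fraction becomes (A + B)/(A
   - B) for even [n] and (A - B)/(A + B) for odd [n]. *)
have -> : (1 + B ^+ 2) / (1 - B ^+ 2) = (A * (1 + B ^+ 2)) / (A * (1 - B ^+ 2)).
  by rewrite -mulf_div divff // mul1r.
rewrite mulrDr mulrBr mulr1 expr2 mulrA.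
case: (odd n) => /= ->; rewrite ?expr1 ?expr0 ?mulN1r ?mul1r.
  (* For odd [n] the exponent -1 turns the fraction over, which gives the even form again. *)
  by rewrite exprN1 invf_div opprK.
by rewrite expr1z.
Qed.

(** Since (phi^l psi^l)^2 = 1, dividing by phi^(2l) amounts to multiplying by psi^(2l), and
    conversely. The bound on [l] keeps the truncated subtraction exact. *)
Lemma fib_double_sub n l : (l <= n)%N ->
  (fib (2 * n - 2 * l))%:R
  = ((phi ^+ n) ^+ 2 * (psi ^+ l) ^+ 2 - (psi ^+ n) ^+ 2 * (phi ^+ l) ^+ 2)
    / Num.sqrt 5.
Proof.
move=> le_ln; rewrite fibE -mulnBr mulnC !exprM; congr (_ / _).
have e1 : (phi ^+ l) ^+ 2 * (psi ^+ l) ^+ 2 = 1.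
  by rewrite -exprMn phi_psi_exp sqrr_sign.
have split_exp x : x ^+ n = x ^+ (n - l) * x ^+ l :> R by rewrite -exprD subnK.
by rewrite !split_exp -[LHS]mulr1 -e1; ring.
Qed.

End Binet.

Theorem theorem1p3 (R : realType) (N l : nat) (hN : (0 < N)%N) (hl : (l < N)%N) :
  ((fib (2 * N - 2 * l))%:R + (-1) ^+ N * (fib (2 * l))%:R
     + (-1) ^+ (l + 1) * (fib (2 * N))%:R)
    / (2^-1 * (lucas (2 * N))%:R - (-1) ^+ N)
  = Num.sqrt 5 * (fib l)%:R ^+ 2 * Cconst R N ^ ((-1 : int) ^+ N)
    - (fib (2 * l))%:R :> R.
Proof.
rewrite Cconst_exp // (fib_double_sub _ (ltnW hl)) !fibE binet_lucas.
(* Every sign is written as a product of powers of [phi] and [psi]. The resulting identity holds for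
   arbitrary [A], [B], [a], [b] with [A - B] nonzero, so the powers can be generalized. *)
rewrite addn1 (exprS (-1) l) mulN1r -!phi_psi_exp !(mulnC 2%N) !exprM.
have dn0 := phi_psi_sub_neq0 R hN; have s0 := sqrt5_neq0 R.
move: (phi R ^+ N) (psi R ^+ N) (phi R ^+ l) (psi R ^+ l) dn0 => A B a b dn0.
have -> : 2^-1 * (A ^+ 2 + B ^+ 2) - A * B = (A - B) ^+ 2 / 2 by field.
field.
by rewrite s0 dn0.
Qed.
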